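(* (a) Let $\gamma=g_1*\dots*g_s\in\Gamma$ with $s\ge1$. Then $\theta(\gamma)=f_{\varepsilon(c(\gamma))}$. (b) A number $n\in\mathbb{N}$ is essential if and only if either $n=0$, or $\mu_1(n)$ is odd and $\mu_1(n)\ge3$. (c) A number $n\in\mathbb{N}$ is essential if and only if $n=\lfloor m\tau\rfloor+\lfloor m\tau^2\rfloor$ for some $m\in\mathbb{N}$, where $\tau=(1+\sqrt5)/2$.
   Context: Let $f_0=f_1=1$, $f_i=f_{i-1}+f_{i-2}$ ($i\ge2$); for a finite set $I$ of positive integers let $f_I=\sum_{i\in I}f_i$. A 2-partition is a finite set of positive integers with consecutive differences $\ge2$; $Z(n)=\{\mu_1(n)<\dots<\mu_q(n)\}$ is the unique 2-partition with $n=f_{Z(n)}$ (Zeckendorf). The canonical form of a nonempty 2-partition is its decomposition into maximal runs $I_1,\dots,I_s$ of consecutive elements of equal parity. The associated vector of $\{i_1<\dots<i_q\}$ is $(\alpha_1,\dots,\alpha_q)$, $\alpha_1=\lfloor(i_1-1)/2\rfloor+1$, $\alpha_r=\lfloor(i_r-i_{r-1})/2\rfloor+1$; cutting it into consecutive blocks of lengths $|I_1|,\dots,|I_s|$ gives $\mathcal{V}(I)=B_1\times\cdots\times B_s$. Define integers $D(\emptyset)=1$, $D(\alpha_1)=\alpha_1$, $D(\alpha_1,\dots,\alpha_r)=\alpha_rD(\alpha_1,\dots,\alpha_{r-1})-D(\alpha_1,\dots,\alpha_{r-2})$. Let $\mathcal{A}_1$ be the set of integer vectors $(\alpha_1,\dots,\alpha_q)$,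 $q\ge1$, with $\alpha_1\ge1$, $\alpha_2,\dots,\alpha_q\ge2$; for $B=(\beta_1,\dots,\beta_q)\in\mathcal{A}_1$ let $\langle B\rangle=D(\beta_2,\dots,\beta_q)/D(\beta_1,\dots,\beta_q)>0$. For each rational $g>0$ there is a unique $c(g)\in\mathcal{A}_1$ with $\langle c(g)\rangle=g$. Let $\Gamma$ be the free monoid generated by the nonzero elements of $\mathbb{Q}/\mathbb{Z}$, each identified with its representative fraction in $(0,1)$; its elements are words $g_1*\dots*g_s$ ($s\ge0$). For $\gamma=g_1*\dots*g_s$ put $c(\gamma)=c(g_1)\times\dots\times c(g_s)$ (a tuple of vectors). Define $\pi:\mathbb{N}\to\Gamma$ by $\pi(0)=$ unit and, for $n\ge1$ with $\mathcal{V}(Z(n))=B_1\times\cdots\times B_s$, $\pi(n)=\overline{\langle B_1\rangle}*\langle B_2\rangle*\cdots*\langle B_s\rangle$, where $\overline{\langle B_1\rangle}$ is the class of $\langle B_1\rangle$ in $\mathbb{Q}/\mathbb{Z}$ (omitted if $0$). $\pi$ is surjective; for $\gamma\in\Gamma$, $\theta(\gamma)$ is the smallest element of $\pi^{-1}(\gamma)$. A number $n$ is essential if $n=\theta(\pi(n))$. For a vector $B=(\beta_1,\dots,\beta_q)$ let $d(B)=\beta_1+\dots+\beta_q-q$ and $\varepsilon(B)=\{2d(\beta_1)+1,2d(\beta_1,\beta_2)+1,\dots,2d(\beta_1,\dots,\beta_q)+1\}$. Let $\sigma^m$ add $m$ to every element of a set. For $B_1\times\dots\times B_s$ put $\varepsilon(B_1\times\dots\times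 B_s)=\varepsilon(B_1)\cup\sigma^{2d(B_1)+1}(\varepsilon(B_2))\cup\dots\cup\sigma^{2d(B_1)+\dots+2d(B_{s-1})+s-1}(\varepsilon(B_s))$. *)

(* Defs.v *)
From HB Require Import structures.
From mathcomp Require Import all_boot all_order all_algebra finmap.
From mathcomp Require Import reals.
From mathcomp Require Import zify ring lra.

Set Implicit Arguments.
Unset Strict Implicit.
Unset Printing Implicit Defensive.

Import Order.TTheory GRing.Theory Num.Theory.

Local Open Scope nat_scope.

Fixpoint fib (n : nat) : nat :=
  if n is (m.+1 as k).+1 then fib k + fib m else 1.
Arguments fib : simpl never.

Definition fibsum (I : {fset nat}) : nat := \sum_(i <- I) fib i.

(* i_1 < ... < i_q *)
Definition elems (I : {fset nat}) : seq nat := sort leq I.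

Definition gap2 : rel nat := fun i j => i + 2 <= j.

Definition is_2partition (I : {fset nat}) : bool :=
  (0 \notin I) && sorted gap2 (elems I).

Lemma fibSS n : fib n.+2 = fib n.+1 + fib n.
Proof. by []. Qed.

Lemma fib_gt0 n : 0 < fib n.
Proof.
suff: (0 < fib n) && (0 < fib n.+1) by case/andP.
elim: n => [//|n /andP[h1 h2]]; rewrite h2 fibSS; lia.
Qed.

Lemma leq_fib m n : m <= n -> fib m <= fib n.
Proof.
apply: (homo_leq (r := leq)) => [//|a b c|]; first exact: leq_trans.
by case=> [//|k]; rewrite fibSS leq_addr.
Qed.

Lemma ltn_fibS n : 0 < n -> fib n < fib n.+1.
Proof. by case: n => // n _; rewrite fibSS; have := fib_gt0 n; lia. Qed.

Lemma leqn_fib n : n <= fib n.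
Proof.
suff: (n <= fib n) && (n.+1 <= fib n.+1) by case/andP.
elim: n => [//|n /andP[h1 h2]]; rewrite h2 fibSS.
by have := fib_gt0 n; lia.
Qed.

Lemma gap2_trans : transitive gap2.
Proof. by move=> a b c; rewrite /gap2; lia. Qed.

Lemma sorted_gap2_ltn s : sorted gap2 s -> sorted ltn s.
Proof. by apply: sub_sorted => i j; rewrite /gap2 /=; lia. Qed.

Lemma elems_seq s : sorted ltn s -> elems [fset x in s]%fset = s.
Proof.
move=> ss; apply: (sorted_eq leq_trans anti_leq).
- exact: (sort_sorted leq_total).
- by apply: sub_sorted ss => i j /=; lia.
rewrite perm_sort; apply: uniq_perm; first exact: fset_uniq.
  by apply: (sorted_uniq ltn_trans ltnn).
by move=> x; rewrite /= in_fset.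
Qed.

Lemma mem_elems I : elems I =i I.
Proof. by move=> x; rewrite mem_sort. Qed.

Lemma elems_inj : injective elems.
Proof. by move=> I J eIJ; apply/fsetP => x; rewrite -mem_elems eIJ mem_elems. Qed.

Lemma fibsum_elems I : fibsum I = \sum_(i <- elems I) fib i.
Proof. by apply: perm_big; rewrite perm_sym perm_sort. Qed.

Lemma is_2partition_seq s : 0 \notin s -> sorted gap2 s ->
  is_2partition [fset x in s]%fset.
Proof.
move=> s0 ss; rewrite /is_2partition elems_seq ?ss ?sorted_gap2_ltn //.
by rewrite in_fset /= s0.
Qed.

Lemma zeckendorf_bound (s : seq nat) (k : nat) : 0 \notin rcons s k -> sorted gap2 (rcons s k) ->
  \sum_(i <- rcons s k) fib i < fib k.+1.
Proof.
elim/last_ind: s k => [|s j IHs] k.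
  rewrite /= big_seq1 inE => k0 _; apply: ltn_fibS; lia.
rewrite mem_rcons inE negb_or => /andP[k0 s0] h.
have hj : j + 2 <= k.
  by move: h; rewrite -cats1 -cats1 -catA /= sorted_cat_cons /= andbT => /andP[].
have hs : sorted gap2 (rcons s j) by move: h; rewrite -[rcons _ k]cats1 => /cat_sorted2[].
have {}IHs := IHs j s0 hs.
rewrite -cats1 big_cat big_seq1 /=.
case: k hj {k0 h} => [|[|k]] hj; try lia.
have hjk : j.+1 <= k.+1 by lia.
by have := leq_fib hjk; rewrite (fibSS k.+1); lia.
Qed.

Lemma zeckendorf_exists n :
  exists I : {fset nat}, is_2partition I && (fibsum I == n).
Proof.
suff [s [s0 ss <-]] : exists s, [/\ 0 \notin s, sorted gap2 s
    & \sum_(i <- s) fib i = n].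
  exists [fset x in s]%fset; rewrite is_2partition_seq //=.
  by rewrite fibsum_elems elems_seq // sorted_gap2_ltn.
have [m] := ubnP n; elim: m n => // m IHm n le_nm.
have [->|n0] := posnP n; first by exists [::]; rewrite big_nil.
have ex1 : exists k, (0 < k) && (fib k <= n) by exists 1.
have ub k : (0 < k) && (fib k <= n) -> k <= n.
  by case/andP=> _; apply: leq_trans; apply: leqn_fib.
case: (ex_maxnP ex1 ub) => k /andP[k0 kn] kmax.
have lt_n : n < fib k.+1.
  by rewrite ltnNge; apply/negP => h; have := kmax k.+1 h; rewrite ltnn.
have [|s [s0 ss sE]] := IHm (n - fib k); first by have := fib_gt0 k; lia.
have hlast i : i \in s -> i + 2 <= k.
  move=> si; case: k k0 kn lt_n sE {kmax} => // k _ kn lt_n sE.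
  have : fib i <= \sum_(i <- s) fib i by rewrite (big_rem i) //= leq_addr.
  rewrite sE => h; have hi : fib i < fib k by rewrite fibSS in lt_n; lia.
  suff : i < k by lia.
  by rewrite ltnNge; apply/negP => /leq_fib; lia.
exists (rcons s k); split.
- by rewrite mem_rcons inE negb_or s0 andbT; lia.
- move: ss; rewrite !(sorted_pairwise gap2_trans) pairwise_rcons => ->; rewrite andbT.
  by apply/allP => i /hlast.
by rewrite -cats1 big_cat big_seq1 sE /=; lia.
Qed.

Lemma zeckendorf_unique I J : is_2partition I -> is_2partition J ->
  fibsum I = fibsum J -> I = J.
Proof.
suff uniq_seq (s t : seq nat) : 0 \notin s -> sorted gap2 s -> 0 \notin t ->
    sorted gap2 t -> \sum_(i <- s) fib i = \sum_(i <- t) fib i -> s = t.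
  case/andP=> I0 sI /andP[J0 sJ] eIJ; apply: elems_inj; apply: uniq_seq => //.
  - by rewrite mem_elems.
  - by rewrite mem_elems.
  by rewrite -!fibsum_elems.
have pos (u : seq nat) (k : nat) : \sum_(i <- rcons u k) fib i >= fib k.
  by rewrite -cats1 big_cat big_seq1 leq_addl.
elim/last_ind: s t => [|s k IHs] t; case/lastP: t => [|t l] //.
- by rewrite big_nil => _ _ _ _ h; have := pos t l; have := fib_gt0 l; lia.
- by rewrite big_nil => _ _ _ _ h; have := pos s k; have := fib_gt0 k; lia.
move=> s0 ss t0 st e.
have bs := zeckendorf_bound s0 ss; have bt := zeckendorf_bound t0 st.
have ps := pos s k; have pt := pos t l.
have ekl : k = l.
  have [h|h|//] := ltngtP k l; first by have := leq_fib h; lia.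
  by have := leq_fib h; lia.
subst l; move: e ss st; rewrite -!cats1 !big_cat /= => /addIn e /cat_sorted2[ss _] /cat_sorted2[st _].
congr cat; apply: IHs => //.
  by apply: contra s0; rewrite mem_rcons inE orbC => ->.
by apply: contra t0; rewrite mem_rcons inE orbC => ->.
Qed.

Definition Z (n : nat) : {fset nat} := xchoose (zeckendorf_exists n).

Lemma Z_2partition n : is_2partition (Z n).
Proof. by case/andP: (xchooseP (zeckendorf_exists n)). Qed.

Lemma fibsum_Z n : fibsum (Z n) = n.
Proof. by case/andP: (xchooseP (zeckendorf_exists n)) => _ /eqP. Qed.

(* mu r n is the r-th smallest element of Z n, with r counted from 1; the value
   is 0 when Z n has fewer than r elements. *)
Definition mu (r n : nat) : nat := nth 0 (elems (Z n)) r.-1.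

Fixpoint runs (s : seq nat) : seq (seq nat) :=
  if s is i :: s' then
    match runs s' with
    | (j :: r) :: rs =>
        if odd i == odd j then (i :: j :: r) :: rs
        else [:: i] :: (j :: r) :: rs
    | _ => [:: [:: i]]
    end
  else [::].

(* Consecutive elements of equal parity, in runs that cannot be extended. *)
Definition parity_runs (rs : seq (seq nat)) : bool :=
  all (fun r => (r != [::]) && constant (map odd r)) rs &&
  sorted (fun r r' => odd (last 0 r) != odd (head 0 r')) rs.

Lemma runsP s : flatten (runs s) = s /\ parity_runs (runs s).
Proof.
elim: s => //= i s [IHf].
case: (runs s) IHf => [|[|j r] rs] /= <-; rewrite /parity_runs //= => /andP[].
move=> /andP[hj hrs] hp; case: (eqVneq (odd i) (odd j)) => [eij|nij] /=.
  split=> //; rewrite /parity_runs /= -eij eqxx /=; move: hj; rewrite -eij => -> /=.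
  by rewrite hrs /=; case: (rs) hp.
by split=> //; rewrite /parity_runs /= hj hrs nij.
Qed.

Lemma runs_unique rs : parity_runs rs -> runs (flatten rs) = rs.
Proof.
elim: rs => [//|r rs IHrs]; rewrite /parity_runs /= => /andP[/andP[hr hrs] hp].
have {}IHrs : runs (flatten rs) = rs.
  by apply: IHrs; rewrite /parity_runs hrs (path_sorted hp).
elim: r hr hp => [//|i [|j r] IHr] /= hr hp.
  rewrite IHrs; case: (rs) hrs hp => [//|[//|k r'] rs'] /= _ /andP[nik _].
  by rewrite (negbTE nik).
have /andP[/eqP eji hr'] := hr.
by rewrite /= in IHr; rewrite IHr ?eji ?eqxx //; case: (rs) hp.
Qed.

Definition canonical_form (I : {fset nat}) : seq (seq nat) := runs (elems I).

(* Since alpha_1 = floor((i_1 - 1)/2) + 1, the general formula for alpha_r also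
   gives alpha_1 if one puts i_0 = 1. *)
Definition assoc_vector (I : {fset nat}) : seq nat :=
  pairmap (fun i j => (j - i) %/ 2 + 1) 1 (elems I).

Definition blocks (I : {fset nat}) : seq (seq nat) :=
  reshape (shape (canonical_form I)) (assoc_vector I).

(* All the integer vectors involved have positive entries, so that vectors are
   sequences of natural numbers. *)

(* Drev (alpha_r, ..., alpha_1) = D (alpha_1, ..., alpha_r) *)
Fixpoint Drev (s : seq nat) : int :=
  match s with
  | [::] => 1
  | [:: a] => a%:Z
  | a :: ((_ :: s'') as s') => (a%:Z * Drev s' - Drev s'')%R
  end.

Definition D (B : seq nat) : int := Drev (rev B).

Definition A1 (B : seq nat) : bool :=
  if B is b :: B' then (1 <= b) && all (leq 2) B' else false.

Definition bracket (B : seq nat) : rat := ((D (behead B))%:Q / (D B)%:Q)%R.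

Lemma Drev_rcons s b a :
  (Drev (rcons (rcons s b) a) = a%:Z * Drev (rcons s b) - Drev s)%R.
Proof.
have [m] := ubnP (size s); elim: m s => // m IHm [|x [|y s]] /= le_sm.
- by ring.
- by ring.
have IH1 := IHm (y :: s); rewrite /= in IH1; rewrite IH1; last lia.
have IH2 := IHm s; case: s le_sm IH1 IH2 => [|z s] /= le_sm IH1 IH2; first by ring.
by rewrite IH2; [ring|lia].
Qed.

Lemma D_cons a b s : (D (a :: b :: s) = a%:Z * D (b :: s) - D s)%R.
Proof. by rewrite /D !rev_cons Drev_rcons. Qed.

Lemma D_ge2 s : all (leq 2) s ->
  [/\ (0 < D s)%R & s != [::] -> (0 < D (behead s) < D s)%R].
Proof.
elim: s => [|a [|b s] IHs]; first by [].
  by rewrite /= andbT /D /= => a2; split=> [|_]; lia.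
rewrite /= => /andP[a2 /andP[b2 s2]].
have [|p] := IHs; first by rewrite /= b2.
rewrite D_cons; move=> /(_ isT)/= /andP[h1 h2]; split=> [|_].
  by nia.
by rewrite p /=; nia.
Qed.

Lemma D_A1 B : A1 B -> (0 < D (behead B))%R /\ (0 < D B)%R.
Proof.
case: B => [//|a [|b s]] /= /andP[a1 h]; first by rewrite /D /=; lia.
have [p /(_ isT)/= /andP[h1 h2]] := @D_ge2 (b :: s) h.
by rewrite D_cons; nia.
Qed.

Lemma bracket_gt0 B : A1 B -> (0 < bracket B)%R.
Proof. by case/D_A1 => h1 h2; rewrite /bracket divr_gt0 ?ltr0z. Qed.

Lemma bracket_lt1 B : B != [::] -> all (leq 2) B -> (0 < bracket B < 1)%R.
Proof.
move=> B0 /D_ge2[p /(_ B0)/andP[h1 h2]].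
rewrite /bracket divr_gt0 ?ltr0z //= ltr_pdivrMr ?ltr0z //.
by rewrite mul1r ltr_int.
Qed.

Lemma bracket_cons b B : B != [::] -> all (leq 2) B ->
  (bracket (b :: B) = (b%:Q - bracket B)^-1)%R.
Proof.
case: B => // a s _ h; have [p _] := D_ge2 h.
rewrite /bracket D_cons /= rmorphB rmorphM /=.
set x := (D (a :: s))%:~R%R; set y := (D s)%:~R%R.
have x0 : (x != 0 :> rat)%R by rewrite intr_eq0; lia.
rewrite -[X in (_ - X / _)%R]/y.
have -> : (b%:~R * x - y = x * (b%:~R - y / x) :> rat)%R by field.
by rewrite invfM mulrA divff // mul1r.
Qed.

Lemma c_exists_frac (a b : nat) : 0 < a -> 0 < b -> exists B,
  [/\ A1 B, bracket B = (a%:Q / b%:Q)%R & a < b -> all (leq 2) B].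
Proof.
have [m] := ubnP a; elim: m a b => // m IHm a b le_am a0 b0.
pose q := (b + a.-1) %/ a.
have hq1 : b <= q * a.
  by have := divn_eq (b + a.-1) a; have := ltn_pmod (b + a.-1) a0; rewrite -/q; lia.
have hq2 : q * a < b + a by have := leq_divM (b + a.-1) a; rewrite -/q; lia.
have q1 : 0 < q by nia.
have q2 : a < b -> 1 < q by nia.
have aQ : (a%:~R != 0 :> rat)%R by rewrite intr_eq0; lia.
have bQ : (b%:~R != 0 :> rat)%R by rewrite intr_eq0; lia.
have [e|r0] := posnP (q * a - b).
  exists [:: q]; split => [||/q2 h]; rewrite /= ?andbT //.
  have -> : b = q * a by lia.
  have qQ : (q%:~R != 0 :> rat)%R by rewrite intr_eq0; lia.
  rewrite /bracket /D /= PoszM rmorphM /=; field.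
  by rewrite aQ qQ.
have [||//|B [AB eB B2]] := IHm (q * a - b) a; [lia|lia|].
have {}B2 : all (leq 2) B by apply: B2; lia.
have B0 : B != [::] by case: (B) AB.
exists (q :: B); split=> [||/q2 h].
- by rewrite /= q1.
- rewrite bracket_cons // eB -subzn // PoszM rmorphB rmorphM /=.
  rewrite -[RHS]invf_div; congr (_^-1)%R.
  by field.
by rewrite /= h.
Qed.

Lemma c_exists (g : rat) : (0 < g)%R -> exists B, A1 B && (bracket B == g).
Proof.
move=> g0; have n0 : (0 < numq g)%R by rewrite numq_gt0.
have [||B [AB eB _]] := @c_exists_frac `|numq g| `|denq g|; rewrite ?absz_gt0.
- by rewrite lt0r_neq0.
- by rewrite denq_eq0.
exists B; rewrite AB eB /= !abszE ger0_norm ?(ltW n0) // ger0_norm.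
  by rewrite divq_num_den.
exact: ltW (denq_gt0 g).
Qed.

Lemma bracket_inj B C : A1 B -> A1 C -> bracket B = bracket C -> B = C.
Proof.
elim: B C => [//|a B IHB] [//|b C] /= /andP[a0 hB] /andP[b0 hC].
have br1 x : (bracket [:: x] = (x%:Q)^-1)%R by rewrite /bracket /D /= div1r.
have int_eq (x y : nat) (u v : rat) : (0 <= u < 1)%R -> (0 <= v < 1)%R ->
    (x%:Q - u = y%:Q - v)%R -> x = y.
  move=> hu hv e; have h1 : (x%:Q < (y + 1)%:Q)%R by rewrite PoszD rmorphD /=; lra.
  have h2 : (y%:Q < (x + 1)%:Q)%R by rewrite PoszD rmorphD /=; lra.
  by move: h1 h2; rewrite !ltr_int; lia.
pose t s := if s is [::] then 0%R else bracket s.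
have brE x s : all (leq 2) s -> (bracket (x :: s) = (x%:Q - t s)^-1)%R.
  by case: s => [|y s] h; [rewrite br1 subr0|rewrite bracket_cons].
have t01 s : all (leq 2) s -> (0 <= t s < 1)%R.
  case: s => [|y s] h; first by [].
  by case/andP: (bracket_lt1 (isT : y :: s != [::]) h) => h1 h2; rewrite /t ltW.
rewrite !brE // => /invr_inj e.
have eab := int_eq _ _ _ _ (t01 _ hB) (t01 _ hC) e.
subst b; congr cons.
have {}e : t B = t C by lra.
have A1ge2 y s : all (leq 2) (y :: s) -> A1 (y :: s).
  by move=> /= /andP[h1 h2]; rewrite h2 andbT; lia.
case: B C IHB e hB hC => [|x B] [|y C] IHB //.
- by move=> e _ h; have /andP[] := bracket_lt1 (isT : y :: C != [::]) h; rewrite -[bracket _]e ltxx.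
- by move=> e h _; have /andP[] := bracket_lt1 (isT : x :: B != [::]) h; rewrite [bracket _]e ltxx.
by move=> e h1 h2; apply: IHB e; apply: A1ge2.
Qed.

Definition c (g : rat) (g_gt0 : (0 < g)%R) : seq nat := xchoose (c_exists g_gt0).

Lemma c_A1 g (g_gt0 : (0 < g)%R) : A1 (c g_gt0).
Proof. by case/andP: (xchooseP (c_exists g_gt0)). Qed.

Lemma bracket_c g (g_gt0 : (0 < g)%R) : bracket (c g_gt0) = g.
Proof. by case/andP: (xchooseP (c_exists g_gt0)) => _ /eqP. Qed.

(* The nonzero elements of Q/Z, as fractions in (0, 1). *)
Definition letter : Type := {g : rat | (0 < g < 1)%R}.

(* The free monoid on letter: the product * is ++ and the unit is [::]. *)
Definition Gamma : Type := seq letter.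

Lemma letter_gt0 (g : letter) : (0 < val g)%R.
Proof. by case/andP: (valP g). Qed.

Definition cword (gamma : Gamma) : seq (seq nat) :=
  [seq c (letter_gt0 g) | g <- gamma].

Definition frac (x : rat) : rat := (x - (Num.floor x)%:~R)%R.

(* Here pmap insub discards the rationals outside (0, 1). By val_Pi below, the
   only one it can discard is frac (bracket B1), when this is 0. *)
Definition Pi (n : nat) : Gamma :=
  if blocks (Z n) is B1 :: Bs then
    pmap insub (frac (bracket B1) :: [seq bracket B | B <- Bs])
  else [::].

Lemma frac_itv x : (0 <= frac x < 1)%R.
Proof.
rewrite /frac; have := floor_itv x; rewrite rmorphD /= => /andP[h1 h2].
by apply/andP; split; lra.
Qed.

Lemma blocks_A1 I B1 Bs : is_2partition I -> blocks I = B1 :: Bs ->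
  A1 B1 /\ all (fun B => (B != [::]) && all (leq 2) B) Bs.
Proof.
case/andP=> I0 sI; rewrite /blocks /canonical_form /assoc_vector.
have {}I0 : 0 \notin elems I by rewrite mem_elems.
have [fl /andP[ne _]] := runsP (elems I).
have hsize : sumn (shape (runs (elems I))) = size (elems I).
  by rewrite -size_flatten fl.
have {ne} : all (leq 1) (shape (runs (elems I))).
  by rewrite all_map; apply: sub_all ne => r /= /andP[]; case: r.
move: hsize; move: (shape _) => sh; case: (elems I) I0 sI => [|i s] I0 sI.
  by case: sh => [//|[|n] sh].
case: sh => [//|[//|n] sh] /= hsize pos_sh.
have : all (leq 2) (pairmap (fun i j => (j - i) %/ 2 + 1) i s).
  elim: s i {hsize I0} sI => //= j s IHs i /andP[hij /IHs ->].
  rewrite addn1 andbT ltnS divn_gt0 //; move: hij; rewrite /gap2; lia.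
have : size (pairmap (fun i j => (j - i) %/ 2 + 1) i s) = n + sumn sh.
  by rewrite size_pairmap; lia.
move: (pairmap _ _ _) => v hv v2 [<- <-]; split.
  rewrite /= addn1 /=; move: v2; rewrite -{1}(cat_take_drop n v) all_cat.
  by case/andP.
have : all (leq 2) (flatten (reshape sh (drop n v))).
  rewrite reshapeKr ?size_drop; last by lia.
  by move: v2; rewrite -{1}(cat_take_drop n v) all_cat => /andP[].
have : all (leq 1) (shape (reshape sh (drop n v))).
  by rewrite reshapeKl // size_drop; lia.
elim: (reshape _ _) => //= B {}Bs IHB /andP[hB1 hB2].
rewrite all_cat => /andP[h1 h2]; rewrite h1 IHB // !andbT.
by case: (B) hB1.
Qed.

Lemma val_Pi n B1 Bs : blocks (Z n) = B1 :: Bs ->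
  [seq val g | g <- Pi n] =
  (if frac (bracket B1) == 0%R then [::] else [:: frac (bracket B1)])
    ++ [seq bracket B | B <- Bs].
Proof.
move=> eB; have [_ hBs] := blocks_A1 (Z_2partition n) eB.
rewrite /Pi eB pmap_filter /=; last exact: insubK.
have -> : [seq x <- [seq bracket B | B <- Bs] | (insub x : option letter)]
    = [seq bracket B | B <- Bs].
  apply/all_filterP; rewrite all_map; apply: sub_all hBs => B /= /andP[B0 B2].
  by rewrite isSome_insub /= bracket_lt1.
rewrite isSome_insub /=; have /andP[h0 ->] := frac_itv (bracket B1).
by rewrite lt_neqAle h0 !andbT eq_sym; case: eqP.
Qed.

(* A 2-partition with prescribed blocks, used to show that Pi is surjective. *)
Fixpoint unblocks (i : nat) (Bs : seq (seq nat)) : seq (seq nat) :=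
  if Bs is B :: Bs' then
    let r := scanl (fun j b => j + 2 * (b - 1)) i B in
    r :: unblocks (last i r).+1 Bs'
  else [::].

Lemma unblocksP i p Bs :
  all (fun B => (B != [::]) && all (leq 2) B) Bs -> p <= i <= p.+1 ->
  [/\ pairmap (fun i j => (j - i) %/ 2 + 1) p (flatten (unblocks i Bs))
        = flatten Bs,
      path gap2 p (flatten (unblocks i Bs)),
      shape (unblocks i Bs) = shape Bs,
      parity_runs (unblocks i Bs) &
      if unblocks i Bs is r :: _ then odd (head 0 r) = odd i else true].
Proof.
pose g j b := j + 2 * (b - 1).
elim: Bs i p => [//|B Bs IHBs] i p /= /andP[/andP[B0 B2] hBs] hip.
rewrite -/g; set r := scanl g i B.
have [] := IHBs (last i r).+1 (last i r) hBs; first by rewrite leqnn leqnSn.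
move=> IH1 IH2 IH3 IH4 IH5.
have r_odd : all (fun j => odd j == odd i) r.
  rewrite /r; elim: (B) (i) => //= b B' IHB j.
  have e : odd (g j b) = odd j by rewrite /g oddD oddM /= addbF.
  by rewrite e eqxx /=; have := IHB (g j b); rewrite e.
have r_pair q : q <= i <= q.+1 ->
    pairmap (fun i j => (j - i) %/ 2 + 1) q r = B /\ path gap2 q r.
  rewrite /r; elim: (B) (i) q B2 => //= b B' IHB j q /andP[b2 hB'] hjq.
  have [|-> ->] := IHB (g j b) (g j b) hB'; first by rewrite leqnn leqnSn.
  rewrite /gap2 /g; split; last by lia.
  by congr cons; lia.
have [rp1 rp2] := r_pair p hip.
have size_r : size r = size B by rewrite size_scanl.
have r0 : r != [::] by rewrite -size_eq0 size_r size_eq0.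
have lastE q : last q r = last i r by case: (r) r0.
have last_odd : odd (last i r) = odd i.
  by have /allP h := r_odd; case: (r) r0 h => // x r' _ h; apply/eqP/h/mem_last.
split.
- by rewrite pairmap_cat rp1 lastE IH1.
- by rewrite cat_path rp2 lastE IH2.
- by rewrite size_r IH3.
- case/andP: IH4 => a1 a2; rewrite /parity_runs /= r0 a1 andbT /=.
  apply/andP; split.
    case: (r) r_odd => //= x r' /andP[/eqP -> h]; rewrite all_map.
    by apply: sub_all h.
  case: (unblocks _ _) a2 IH5 => //= r' rs -> ->.
  by rewrite andbT lastE /= last_odd; case: odd.
by case: (r) r_odd r0 => //= x r' /andP[/eqP].
Qed.

Lemma blocks_surj Bs : all (fun B => (B != [::]) && all (leq 2) B) Bs ->
  exists2 I, is_2partition I & blocks I = Bs.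
Proof.
move=> hBs; have [//|h1 h2 h3 h4 _] := @unblocksP 1 1 Bs hBs.
pose s := flatten (unblocks 1 Bs).
have ss : sorted gap2 s := path_sorted h2.
exists [fset x in s]%fset.
  apply: is_2partition_seq => //.
  move: h2; rewrite (path_sortedE gap2_trans) => /andP[/allP h _].
  by apply/negP => /h.
rewrite /blocks /canonical_form /assoc_vector elems_seq ?sorted_gap2_ltn //.
by rewrite runs_unique // h1 h3 flattenK.
Qed.

Lemma c_ge2 (g : letter) : all (leq 2) (c (letter_gt0 g)).
Proof.
have := c_A1 (letter_gt0 g); have := bracket_c (letter_gt0 g).
case: (c _) => [//|b B] eB /= /andP[b1 hB]; rewrite hB andbT.
rewrite ltn_neqAle b1 andbT; apply/negP => /eqP e1.
have /andP[_] := valP g; rewrite -eB -e1.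
case: B hB {eB} => [|a B] hB; first by rewrite /bracket /D /= divr1 ltxx.
have /andP[h1 h2] := bracket_lt1 (isT : a :: B != [::]) hB.
rewrite bracket_cons // invf_lt1; first by lra.
by rewrite subr_gt0.
Qed.

Lemma Pi_surj (gamma : Gamma) : exists n, Pi n == gamma.
Proof.
have hc : all (fun B => (B != [::]) && all (leq 2) B) (cword gamma).
  rewrite all_map; apply/allP => g _ /=; rewrite c_ge2 andbT.
  by have := c_A1 (letter_gt0 g); case: (c _).
have [I hI eI] := blocks_surj hc.
exists (fibsum I).
have ZI : Z (fibsum I) = I.
  by apply: zeckendorf_unique; rewrite ?Z_2partition ?fibsum_Z.
rewrite /Pi ZI eI; case: gamma {hc eI} => [//|g gamma] /=.
rewrite -map_comp (eq_map (g := val)); last first.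
  by move=> h /=; rewrite bracket_c.
have -> : frac (bracket (c (letter_gt0 g))) = val g.
  rewrite bracket_c /frac; have /andP[h0 h1] := valP g.
  by rewrite (floor_def (m := 0)) ?subr0 // (ltW h0) add0r.
by rewrite valK /= map_pK //; apply: valK.
Qed.

Definition theta (gamma : Gamma) : nat := ex_minn (Pi_surj gamma).

Definition essential (n : nat) : Prop := n = theta (Pi n).

(* On the vectors considered each entry is positive, so that the subtraction is
   never truncated. *)
Definition d (B : seq nat) : nat := sumn B - size B.

Definition eps (B : seq nat) : {fset nat} :=
  [fset (2 * d (take k B) + 1)%N | k in iota 1 (size B)]%fset.

Definition sigma (m : nat) (I : {fset nat}) : {fset nat} :=
  [fset (m + i)%N | i in I]%fset.

Definition epsw (Bs : seq (seq nat)) : {fset nat} :=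
  (\bigcup_(j <- iota 0 (size Bs))
     sigma (\sum_(B <- take j Bs) 2 * d B + j)%N (eps (nth [::] Bs j)))%fset.

Definition tau (R : realType) : R := ((1 + Num.sqrt 5) / 2)%R.

(* Main.v *)
(* A 2-partition is determined by its blocks B_1, ..., B_s and the parity of its
   least element: its elements are recovered by starting from 1 or 2 and adding
   2 (b - 1) for each entry b, and 1 more at the end of each block.  Moving the
   start from 2 to 1 lowers every element.  A first block (1, b + 1, ...) may be
   replaced by (b, ...), which changes its bracket by 1 and only lowers the sum
   of the Fibonacci numbers, and so does dropping a first block (1).  Hence the
   least n with pi(n) = gamma has blocks c(gamma) and starts from 1, and the
   essential n are those built from 1 with all entries at least 2, that is those
   with mu_1(n) odd and at least 3.

   For (c), every m is a sum of f_j over indices j >= 0 with gaps at least 2 and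
   even least index.  With y = 1 - tau we have f_(j+1) = f_j tau + y^(j+1), and
   for such an index set the y^(j+1) add up to a number in (-1, 0], so that
   floor(m tau) is the sum of the f_(j+1), and floor(m tau) + floor(m tau^2) =
   2 floor(m tau) + m is the sum of the f_(j+3). *)

Require Import Defs.
From mathcomp Require Import all_boot all_order all_algebra finmap.
From mathcomp Require Import reals.
From mathcomp Require Import zify ring lra.

Set Implicit Arguments.
Unset Strict Implicit.
Unset Printing Implicit Defensive.

Import Order.TTheory GRing.Theory Num.Theory.

Local Open Scope nat_scope.

(* [all_algebra] shadows this name by the fractions of fraction.v. *)
Local Notation frac := Defs.frac.

(* [next_index] inverts [vector_entry] on integers of equal parity. *)
Definition vector_entry (i j : nat) : nat := (j - i) %/ 2 + 1.
Definition next_index (i b : nat) : nat := i + 2 * (b - 1).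

Definition proper (B : seq nat) : bool := (B != [::]) && all (leq 2) B.

Definition indices (i : nat) (Bs : seq (seq nat)) : seq nat :=
  flatten (unblocks i Bs).

Definition index_sum (i : nat) (Bs : seq (seq nat)) : nat :=
  \sum_(j <- indices i Bs) fib j.

Lemma next_index_addn m i b : next_index (m + i) b = m + next_index i b.
Proof. by rewrite /next_index addnA. Qed.

Lemma scanl_next_index_addn m i B :
  scanl next_index (m + i) B = map (addn m) (scanl next_index i B).
Proof. by elim: B i => //= b B IHB i; rewrite next_index_addn IHB. Qed.

Lemma foldl_next_index_addn m i B :
  foldl next_index (m + i) B = m + foldl next_index i B.
Proof. by elim: B i => //= b B IHB i; rewrite next_index_addn IHB. Qed.

Lemma last_scanl (T U : Type) (f : T -> U -> T) x s :
  last x (scanl f x s) = foldl f x s.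
Proof. by elim: s x => //= y s <-; case: s. Qed.

Lemma scanlE (T U : Type) (f : T -> U -> T) x s :
  scanl f x s = [seq foldl f x (take k s) | k <- iota 1 (size s)].
Proof.
apply: (@eq_from_nth _ x) => [|k]; rewrite size_scanl ?size_map ?size_iota //.
by move=> ks; rewrite nth_scanl // (nth_map 0) ?size_iota // nth_iota.
Qed.

Lemma leq_foldl_next_index i B : i <= foldl next_index i B.
Proof.
by elim: B i => //= b B IHB i; apply: leq_trans (leq_addr _ _) (IHB _).
Qed.

Lemma indices_cons i B Bs : indices i (B :: Bs) =
  scanl next_index i B ++ indices (foldl next_index i B).+1 Bs.
Proof. by rewrite /indices /= last_scanl. Qed.

Lemma indices_addn m i Bs :
  indices (m + i) Bs = map (addn m) (indices i Bs).
Proof.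
elim: Bs i => // B Bs IHBs i; rewrite !indices_cons map_cat -IHBs.
by rewrite scanl_next_index_addn foldl_next_index_addn addnS.
Qed.

Lemma index_sum_cons i B Bs : index_sum i (B :: Bs) =
  \sum_(j <- scanl next_index i B) fib j
    + index_sum (foldl next_index i B).+1 Bs.
Proof. by rewrite /index_sum indices_cons big_cat. Qed.

Lemma leq_index_sum i j Bs : i <= j -> index_sum i Bs <= index_sum j Bs.
Proof.
move=> ij; rewrite /index_sum -(subnK ij) indices_addn big_map.
by apply: leq_sum => k _; rewrite leq_fib ?leq_addl.
Qed.

Lemma leq_index_sum_cons i B Bs : index_sum i Bs <= index_sum i (B :: Bs).
Proof.
rewrite index_sum_cons; apply: leq_trans (leq_addl _ _).
by rewrite leq_index_sum // leqW ?leq_foldl_next_index.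
Qed.

Lemma index_sum_cons1 i b B Bs : 0 < b ->
  index_sum i ((1 :: b.+1 :: B) :: Bs)
    = fib i + index_sum i.+2 ((b :: B) :: Bs).
Proof.
move=> b0; rewrite !index_sum_cons /= !big_cons.
have -> : next_index i 1 = i by rewrite /next_index muln0 addn0.
have -> : next_index i b.+1 = next_index i.+2 b; last by rewrite !addnA.
by rewrite /next_index; lia.
Qed.

Lemma scanl_pairmap i p r : path leq p r -> p <= i <= p.+1 ->
  all (fun j => odd j == odd i) r ->
  scanl next_index i (pairmap vector_entry p r) = r.
Proof.
elim: r i p => [//|j r IHr] i p /= /andP[pj jr] pi /andP[/eqP oj ar].
have -> : next_index i (vector_entry p j) = j.
  by rewrite /next_index /vector_entry; lia.
by congr cons; apply: IHr; rewrite ?leqnn ?leqnSn ?oj.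
Qed.

Lemma parity_runs_head r rs i :
  parity_runs (r :: rs) -> odd (head 0 r) = odd i ->
  all (fun j => odd j == odd i) r.
Proof.
case/andP=> /= /andP[/andP[r0 cr] _] _; case: r r0 cr => //= j r _ cr <-.
by rewrite eqxx; move: cr; rewrite all_map.
Qed.

Lemma unblocks_runs i p rs : parity_runs rs -> path leq p (flatten rs) ->
  p <= i <= p.+1 -> (rs != [::] -> odd (head 0 (flatten rs)) = odd i) ->
  unblocks i (reshape (shape rs) (pairmap vector_entry p (flatten rs))) = rs.
Proof.
elim: rs i p => [//|r rs IHrs] i p hrs.
have /andP[/= /andP[/andP[r0 _] ars] srs] := hrs.
have hd : head 0 (r ++ flatten rs) = head 0 r by case: (r) r0.
rewrite cat_path hd => /andP[pr prs] pi /(_ isT) oi.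
rewrite pairmap_cat take_size_cat ?drop_size_cat ?size_pairmap //.
rewrite [scanl _ _ _]scanl_pairmap ?(parity_runs_head hrs) //; congr cons.
have lastE q : last q r = last p r by case: (r) r0.
rewrite lastE; apply: IHrs; rewrite ?leqnn ?leqnSn //.
  by rewrite /parity_runs ars (path_sorted srs).
case: rs srs ars {hrs hd prs} => [//|[//|k r'] rs] /= /andP[h _] _ _.
by move: h; rewrite lastE; do 2!case: odd.
Qed.

Lemma elems_indices I : is_2partition I ->
  elems I = indices (if odd (head 0 (elems I)) then 1 else 2) (blocks I).
Proof.
case/andP=> I0 sI; rewrite /blocks /canonical_form /assoc_vector /indices.
have [flE pr] := runsP (elems I).
rewrite -{4}flE unblocks_runs ?flE //; [|by case: ifP|by move=> _; case: ifP].
rewrite -mem_elems in I0; case: (elems I) I0 sI => //= i s.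
rewrite inE negb_or lt0n eq_sym => /andP[-> _].
by apply: sub_path => a b; rewrite /gap2; lia.
Qed.

Lemma Z_fibsum I : is_2partition I -> Z (fibsum I) = I.
Proof.
by move=> hI; apply: zeckendorf_unique; rewrite ?Z_2partition ?fibsum_Z.
Qed.

Lemma elems_Z_sum s : 0 \notin s -> sorted gap2 s ->
  elems (Z (\sum_(i <- s) fib i)) = s.
Proof.
move=> s0 ss; have sE := elems_seq (sorted_gap2_ltn ss).
by rewrite -{1}sE -fibsum_elems Z_fibsum ?sE // is_2partition_seq.
Qed.

Lemma sum_elems_Z n : \sum_(i <- elems (Z n)) fib i = n.
Proof. by rewrite -fibsum_elems fibsum_Z. Qed.

Lemma sorted_elems_Z n : sorted gap2 (elems (Z n)).
Proof. by case/andP: (Z_2partition n). Qed.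

Lemma path_gap2_indices Bs : all proper Bs -> path gap2 1 (indices 1 Bs).
Proof. by move=> hBs; have [] := @unblocksP 1 1 Bs hBs isT. Qed.

Lemma elems_Z_index_sum Bs : all proper Bs ->
  elems (Z (index_sum 1 Bs)) = indices 1 Bs.
Proof.
move=> /path_gap2_indices; rewrite (path_sortedE gap2_trans).
by move=> /andP[/allP ge3 gap_s]; apply: elems_Z_sum => //; apply/negP => /ge3.
Qed.

Lemma blocks_Z_index_sum Bs : all proper Bs -> blocks (Z (index_sum 1 Bs)) = Bs.
Proof.
move=> hBs; have [//|pE _ shapeE pr _] := @unblocksP 1 1 Bs hBs.
rewrite /blocks /canonical_form /assoc_vector elems_Z_index_sum //.
by rewrite runs_unique // pE shapeE flattenK.
Qed.

Lemma index_sum_blocks_le n : index_sum 1 (blocks (Z n)) <= n.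
Proof.
rewrite -[n in X in _ <= X]sum_elems_Z (elems_indices (Z_2partition n)).
by apply: leq_index_sum; case: ifP.
Qed.

Lemma proper_A1 B : proper B -> A1 B.
Proof. by case: B => // b B /andP[_ /= /andP[b2 ->]]; rewrite ltnW. Qed.

Lemma bracket_itv B : proper B -> (0 < bracket B < 1)%R.
Proof. by case/andP=> B0; apply: bracket_lt1. Qed.

Lemma A1_ind (P : seq nat -> Prop) :
  P [:: 1] -> (forall B, proper B -> P B) ->
  (forall b B, A1 (b :: B) -> P (b :: B) -> P (1 :: b.+1 :: B)) ->
  forall B, A1 B -> P B.
Proof.
move=> P1 Pproper Pcons [//|b B]; elim: B b => [|a B IHB] [|[|b]] //= hB.
- exact: Pproper.
- case: a hB => [|a] //= /andP[a0 hB].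
  by apply: Pcons; [|apply: IHB]; rewrite /= hB andbT.
- exact: Pproper.
Qed.

Lemma D_consS b B : (D (b.+1 :: B) = D (b :: B) + D B)%R.
Proof. by case: B => [|a B]; rewrite ?D_cons ?/D /=; lia. Qed.

(* An entry 1 in front stands for the integral part. *)
Lemma bracket_cons1 b B : (D (b :: B) != 0)%R ->
  (bracket (1%N :: b.+1 :: B) = 1 + bracket (b :: B))%R.
Proof.
move=> D0; rewrite /bracket /= D_cons mul1r D_consS addrK rmorphD /=.
by rewrite mulrDl divff ?intr_eq0.
Qed.

Lemma frac_add1 (x : rat) : (frac (1 + x) = frac x)%R.
Proof. by rewrite /frac floorDzr ?rpred1 // floor1 rmorphD /=; lra. Qed.

Lemma frac_id (x : rat) : (0 <= x < 1)%R -> frac x = x.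
Proof. by move=> h; rewrite /frac (floor_def (m := 0)) ?subr0. Qed.

Lemma frac_bracket_proper B : proper B -> frac (bracket B) = bracket B.
Proof. by move=> /bracket_itv/andP[h0 h1]; rewrite frac_id // ltW. Qed.

Lemma cword_proper gamma : all proper (cword gamma).
Proof.
rewrite all_map; apply/allP => g _; rewrite /= /proper c_ge2 andbT.
by have := c_A1 (letter_gt0 g); case: (c _).
Qed.

Lemma bracket_cword gamma : [seq bracket B | B <- cword gamma] = map val gamma.
Proof. by rewrite -map_comp; apply: eq_map => g /=; rewrite bracket_c. Qed.

Lemma cword_bracket Bs (gamma : Gamma) : all proper Bs ->
  map val gamma = [seq bracket B | B <- Bs] -> cword gamma = Bs.
Proof.
elim: Bs gamma => [|B Bs IHBs] [|g gamma] //= /andP[hB hBs] [gE gammaE].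
by rewrite IHBs // (@bracket_inj (c _) B) ?c_A1 ?bracket_c ?proper_A1.
Qed.

Lemma val_Pi_index_sum Bs : all proper Bs ->
  map val (Pi (index_sum 1 Bs)) = [seq bracket B | B <- Bs].
Proof.
move=> hBs; have blocksE := blocks_Z_index_sum hBs.
case: Bs hBs blocksE => [|B Bs] hBs blocksE; first by rewrite /Pi blocksE.
case/andP: hBs => hB _; have /andP[B0 _] := bracket_itv hB.
by rewrite (val_Pi blocksE) frac_bracket_proper // gt_eqF.
Qed.

Lemma Pi_index_sum gamma : Pi (index_sum 1 (cword gamma)) = gamma.
Proof.
apply: (inj_map val_inj).
by rewrite val_Pi_index_sum ?cword_proper ?bracket_cword.
Qed.

Lemma cword_Pi_index_sum Bs : all proper Bs -> cword (Pi (index_sum 1 Bs)) = Bs.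
Proof. by move=> hBs; apply/cword_bracket/val_Pi_index_sum. Qed.

(* Removing a leading entry 1 lowers the bracket by 1, and in the sum it drops
   the smallest index while moving the others down by 2. *)
Lemma leq_index_sum_cword i B Bs (gamma : Gamma) : A1 B -> all proper Bs ->
  map val gamma =
    (if frac (bracket B) == 0%R then [::] else [:: frac (bracket B)])
      ++ [seq bracket B | B <- Bs] ->
  index_sum i (cword gamma) <= index_sum i (B :: Bs).
Proof.
move=> hB hBs; elim/A1_ind: B / hB i => [|B hB|b B hB IHB] i.
- have -> : frac (bracket [:: 1]) = 0%R by rewrite /bracket /D /= divr1.
  by rewrite eqxx => /(cword_bracket hBs) ->; apply: leq_index_sum_cons.
- have /andP[B0 _] := bracket_itv hB; rewrite frac_bracket_proper // gt_eqF //.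
  by move=> gammaE; rewrite (@cword_bracket (B :: Bs)) //= hB.
have [_ D_gt0] := D_A1 hB.
rewrite bracket_cons1 ?frac_add1; last by rewrite gt_eqF.
move=> /IHB le_sum.
rewrite index_sum_cons1; last by case/andP: hB.
apply: leq_trans (leq_addl _ _); apply: leq_trans (le_sum i.+2).
by rewrite leq_index_sum // !leqW.
Qed.

Lemma index_sum_cword_Pi_le n : index_sum 1 (cword (Pi n)) <= n.
Proof.
have := index_sum_blocks_le n; case nE: (blocks (Z n)) => [|B Bs].
  by rewrite /Pi nE /index_sum big_nil.
have [hB hBs] := blocks_A1 (Z_2partition n) nE.
by apply: leq_trans; apply: leq_index_sum_cword (val_Pi nE).
Qed.

Lemma theta_index_sum gamma : theta gamma = index_sum 1 (cword gamma).
Proof.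
rewrite /theta; case: ex_minnP => n /eqP <- nmin; apply/eqP.
by rewrite eqn_leq index_sum_cword_Pi_le nmin ?Pi_index_sum.
Qed.

Lemma d_cons b B : 0 < b -> all (leq 1) B -> d (b :: B) = b - 1 + d B.
Proof.
move=> b0 hB; suff : size B <= sumn B by rewrite /d /=; lia.
by elim: B hB => //= a B IHB /andP[a0 /IHB]; lia.
Qed.

Lemma foldl_next_index i B : all (leq 1) B ->
  foldl next_index i B = i + 2 * d B.
Proof.
elim: B i => [|b B IHB] i /=; first by rewrite addn0.
by move=> /andP[b0 hB]; rewrite IHB // d_cons // /next_index; lia.
Qed.

Lemma epsE B : all (leq 1) B -> eps B = [fset x in scanl next_index 1 B]%fset.
Proof.
move=> hB; have foldE k : foldl next_index 1 (take k B) = 2 * d (take k B) + 1.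
  rewrite foldl_next_index 1?addnC //; apply/allP => b /mem_take.
  exact: (allP hB).
apply/fsetP => x; rewrite in_fset scanlE (eq_map foldE).
by apply/imfsetP/mapP.
Qed.

Lemma sigma_seq m s :
  sigma m [fset x in s]%fset = [fset x in map (addn m) s]%fset.
Proof.
apply/fsetP => x; rewrite in_fset.
by apply/imfsetP/mapP => -[y ys ->]; exists y => //; move: ys; rewrite in_fset.
Qed.

Lemma sigma0 I : sigma 0 I = I.
Proof.
apply/fsetP => x; apply/imfsetP/idP => [[y yI ->] //|xI].
by exists x.
Qed.

Lemma sigma_sigma m n I : sigma m (sigma n I) = sigma (m + n) I.
Proof.
by rewrite /sigma -imfset_comp; apply: eq_imfset => // x; rewrite /= addnA.
Qed.

Lemma epsw_cons B Bs :
  epsw (B :: Bs) = (eps B `|` sigma (2 * d B + 1) (epsw Bs))%fset.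
Proof.
rewrite /epsw /= big_cons take0 big_nil sigma0; congr fsetU.
rewrite (iotaDl 1 0) big_map (big_morph (sigma _) (imfsetU _) (imfset0 _)).
apply: eq_bigr => j _; rewrite sigma_sigma /= big_cons; congr sigma.
by rewrite add0n -!addnA (addnCA 1).
Qed.

Lemma epswE Bs : all (all (leq 1)) Bs ->
  epsw Bs = [fset x in indices 1 Bs]%fset.
Proof.
elim: Bs => [_|B Bs IHBs /= /andP[hB hBs]].
  by rewrite /epsw /= big_nil; apply/fsetP => x; rewrite in_fset.
rewrite epsw_cons IHBs // epsE // sigma_seq -indices_addn indices_cons.
rewrite foldl_next_index // addnC addn1 -addnS.
by apply/fsetP => x; rewrite in_fsetU !in_fset mem_cat.
Qed.

Lemma fibsum_epsw Bs : all proper Bs -> fibsum (epsw Bs) = index_sum 1 Bs.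
Proof.
move=> hBs; rewrite epswE ?fibsum_elems ?elems_seq //.
  by rewrite sorted_gap2_ltn // (path_sorted (path_gap2_indices hBs)).
apply: sub_all hBs => B /andP[_]; apply: sub_all => b; exact: ltnW.
Qed.

Lemma essential_index_sum n :
  essential n <-> exists2 Bs, all proper Bs & n = index_sum 1 Bs.
Proof.
rewrite /essential theta_index_sum; split=> [nE|[Bs hBs ->]].
- by exists (cword (Pi n)); first exact: cword_proper.
- by rewrite cword_Pi_index_sum.
Qed.

Lemma proper_blocks_Z n : odd (mu 1 n) -> 3 <= mu 1 n ->
  all proper (blocks (Z n)).
Proof.
rewrite /mu nth0 => odd_mu; have := elems_indices (Z_2partition n).
rewrite odd_mu => ->; case nE: (blocks (Z n)) => [//|B Bs].
have [hB hBs] := blocks_A1 (Z_2partition n) nE.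
case: B hB {nE} => [//|b B] /= /andP[_ hB]; rewrite /next_index => n3.
by rewrite /proper /= hB hBs !andbT; lia.
Qed.

Lemma essential_mu n : essential n <-> n = 0 \/ odd (mu 1 n) /\ 3 <= mu 1 n.
Proof.
rewrite essential_index_sum; split=> [[[|B Bs] hBs ->]|].
- by left; rewrite /index_sum big_nil.
- right; rewrite /mu nth0 elems_Z_index_sum // indices_cons.
  case/andP: hBs => /andP[]; case: B => [//|b B] _ /= /andP[b2 _] _.
  by rewrite /next_index; lia.
case=> [->|[odd_mu mu3]]; first by exists [::]; rewrite // /index_sum big_nil.
exists (blocks (Z n)); first exact: proper_blocks_Z.
have := elems_indices (Z_2partition n).
rewrite -nth0 [nth _ _ _]/(mu 1 n) odd_mu /index_sum => <-.
by rewrite sum_elems_Z.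
Qed.

Definition even_gap2 (s : seq nat) : bool := sorted gap2 s && ~~ odd (head 0 s).

Lemma sorted_gap2_addn k s : sorted gap2 (map (addn k) s) = sorted gap2 s.
Proof.
rewrite sorted_map; apply: eq_sorted => i j.
by rewrite /gap2 /= -addnA leq_add2l.
Qed.

Lemma sorted_gap2_shift k i s : sorted gap2 (i :: s) -> k <= i ->
  exists2 t, sorted gap2 t & i :: s = map (addn k) t.
Proof.
move=> gap_s ki; have tE : i :: s = map (addn k) (map (subn^~ k) (i :: s)).
  rewrite -map_comp map_id_in // => j; rewrite inE => /predU1P[->|js] /=.
    exact: subnKC.
  have /allP/(_ j js) := order_path_min gap2_trans gap_s.
  by rewrite /gap2; lia.
by exists (map (subn^~ k) (i :: s)); rewrite // -(sorted_gap2_addn k) -tE.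
Qed.

Lemma even_gap2_of_odd_head k s : path gap2 k.*2 s -> exists2 t, even_gap2 t &
  \sum_(i <- t) fib i = \sum_(i <- k.*2.+1 :: s) fib i.
Proof.
(* fib (2 k + 1) = fib 0 + fib 2 + ... + fib (2 k) *)
elim: k s => [|k IHk] s gap_s.
  by exists (0 :: s); rewrite ?big_cons // /even_gap2 /= gap_s.
have [|t even_t tE] := IHk (k.+1.*2 :: s); first by rewrite /= gap_s /gap2; lia.
exists t; rewrite // tE !big_cons doubleS (fibSS k.*2.+1); lia.
Qed.

Lemma even_zeckendorf m : exists2 s, even_gap2 s & m = \sum_(i <- s) fib i.
Proof.
have := sorted_elems_Z m; rewrite -{2}(sum_elems_Z m).
case: (elems (Z m)) => [|i s gap_s]; first by exists [::].
have [odd_i|even_i] := boolP (odd i); last first.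
  by exists (i :: s); rewrite // /even_gap2 gap_s.
have iE : i = i./2.*2.+1 by rewrite -{1}(odd_double_half i) odd_i.
have [|t even_t tE] := @even_gap2_of_odd_head i./2 s.
  by case: s gap_s => //= j s; rewrite /gap2; lia.
by exists t; rewrite // tE -iE.
Qed.

Lemma essential_even_gap2 n :
  essential n <-> exists2 s, even_gap2 s & n = \sum_(i <- s) fib (3 + i).
Proof.
rewrite essential_mu /mu nth0.
split=> [[->|[odd_n n3]]|[s /andP[gap_s even_s] ->]].
- by exists [::]; rewrite ?big_nil.
- have := sum_elems_Z n; have := sorted_elems_Z n.
  case: (elems (Z n)) odd_n n3 => // i s odd_i i3.
  move=> /sorted_gap2_shift/(_ i3)[t gap_t tE].
  rewrite tE big_map => <-; exists t; rewrite // /even_gap2 gap_t /=.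
  by case: t tE {gap_t} => //= j t [jE _]; rewrite jE oddD in odd_i.
rewrite -(big_map (addn 3) xpredT fib) elems_Z_sum ?sorted_gap2_addn //.
  case: s even_s {gap_s} => [|i s] /= even_i; first by left; rewrite big_nil.
  by right; rewrite even_i.
by apply/mapP => -[].
Qed.

Local Open Scope ring_scope.

Lemma fibS_golden (A : comPzRingType) (x : A) j : x ^+ 2 = x + 1 ->
  (fib j.+1)%:R = (fib j)%:R * x + (1 - x) ^+ j.+1.
Proof.
move=> x2; have y2 : (1 - x) ^+ 2 = (1 - x) + 1 by rewrite sqrrB x2; ring.
suff : (fib j.+1)%:R = (fib j)%:R * x + (1 - x) ^+ j.+1 /\
       (fib j.+2)%:R = (fib j.+1)%:R * x + (1 - x) ^+ j.+2 by case.
elim: j => [|j [IHj IHj1]].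
  by rewrite y2 expr1 !fibSS /fib; split; ring.
split=> //; rewrite (fibSS j.+1) natrD {1}IHj1 {2}IHj (fibSS j) natrD.
by rewrite -[j.+3]addn2 exprD y2 exprS; ring.
Qed.

Lemma golden_conj_gtN1 (R : realDomainType) (y : R) :
  y ^+ 2 = y + 1 -> y < 0 -> -1 < y.
Proof.
move=> y2 y_lt0; have : 0 < y ^+ 2 by rewrite exprn_even_gt0 //= lt_eqF.
by rewrite y2; lra.
Qed.

Lemma expr_golden_conj_itv (R : realDomainType) (y : R) n :
  y ^+ 2 = y + 1 -> y < 0 -> y <= y ^+ n <= 1.
Proof.
move=> y2 y_lt0; have y1 := golden_conj_gtN1 y2 y_lt0.
elim: n => [|n /andP[le_y le_1]]; first by rewrite expr0 lexx andbT; lra.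
by rewrite exprS; apply/andP; split; nra.
Qed.

(* The bound 1 - y is the infinite sum 1 + y^2 + y^4 + ... *)
Lemma sum_expr_golden_conj (R : realFieldType) (y : R) j s :
  y ^+ 2 = y + 1 -> y < 0 -> path gap2 j s ->
  0 < (\sum_(i <- j :: s) y ^+ i) / y ^+ j < 1 - y.
Proof.
move=> y2 y_lt0; have y1 := golden_conj_gtN1 y2 y_lt0.
have y0 k : y ^+ k != 0 by rewrite expf_neq0 ?lt_eqF.
elim: s j => [|k s IHs] j; first by rewrite big_seq1 divff // => _; lra.
move=> /= /andP[jk /IHs]; rewrite big_cons mulrDl divff //.
set S := \sum_(_ <- _) _ => S_itv.
have -> : S / y ^+ j = (y + 1) * (y ^+ (k - (j + 2)) * (S / y ^+ k)).
  by rewrite -y2 -[in y ^+ k](subnKC jk) !exprD; field; rewrite !y0 lt_eqF.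
have := expr_golden_conj_itv (k - (j + 2)) y2 y_lt0.
set p := y ^+ _; set r := S / _ in S_itv * => p_itv.
have pr_itv : -1 < p * r < 1 - y by apply/andP; split; nra.
by apply/andP; split; nra.
Qed.

Lemma floor_mul_golden (R : archiRealFieldType) (t : R) s :
  t ^+ 2 = t + 1 -> 0 < t -> even_gap2 s ->
  Num.floor ((\sum_(i <- s) fib i)%N%:R * t) = (\sum_(i <- s) fib i.+1)%N%:Z.
Proof.
move=> t2 t_gt0 even_s; set y := 1 - t.
have y2 : y ^+ 2 = y + 1 by rewrite sqrrB t2 /y; ring.
have y_lt0 : y < 0 by rewrite /y; nra.
have sumE : (\sum_(i <- s) fib i.+1)%N%:R =
    (\sum_(i <- s) fib i)%N%:R * t + y * \sum_(i <- s) y ^+ i.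
  rewrite !natr_sum mulr_suml mulr_sumr -big_split; apply: eq_bigr => i _.
  by rewrite /= (fibS_golden _ t2) exprS.
have err_itv : -1 < y * \sum_(i <- s) y ^+ i <= 0.
  case: s even_s {sumE} => [|j s] /andP[gap_s even_j].
    by rewrite big_nil mulr0 lexx ltrN10.
  have yj_gt0 : 0 < y ^+ j by rewrite exprn_even_gt0 // (lt_eqF y_lt0) orbT.
  have /andP[_ yj_le1] := expr_golden_conj_itv j y2 y_lt0.
  rewrite -[\sum_(_ <- _) _](divfK (lt0r_neq0 yj_gt0)).
  have := sum_expr_golden_conj y2 y_lt0 gap_s; move: (_ / _) => r r_itv.
  have yr_itv : -1 < y * r < 0 by apply/andP; split; nra.
  by rewrite mulrA; apply/andP; split; nra.
by apply: floor_def; rewrite rmorphD /= -!pmulrn sumE; apply/andP; split; lra.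
Qed.

Lemma floor_golden_sum (R : archiRealFieldType) (t : R) :
  t ^+ 2 = t + 1 -> 0 < t ->
  forall s (m := (\sum_(i <- s) fib i)%N), even_gap2 s ->
  Num.floor (m%:R * t) + Num.floor (m%:R * t ^+ 2)
    = (\sum_(i <- s) fib (3 + i))%N%:Z.
Proof.
move=> t2 t_gt0 s m even_s.
have -> : Num.floor (m%:R * t ^+ 2) = Num.floor (m%:R * t) + m%:Z.
  by rewrite t2 mulrDr mulr1 floorDrz ?natr_int // pmulrn intrKfloor.
rewrite floor_mul_golden // -!PoszD -!big_split; congr Posz.
by apply: eq_bigr => i _; rewrite /= (fibSS i.+1) fibSS; lia.
Qed.

Lemma tau_sqr (R : realType) : tau R ^+ 2 = tau R + 1.
Proof.
have sqrt5 : Num.sqrt (5 : R) ^+ 2 = 5 by rewrite sqr_sqrtr.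
by rewrite /tau expr_div_n sqrrD sqrt5; field.
Qed.

Lemma tau_gt0 (R : realType) : 0 < tau R.
Proof. by rewrite divr_gt0 // ltr_wpDr ?sqrtr_ge0. Qed.

Theorem theorem3p4 (R : realType) :
  [/\ (forall gamma : Gamma, (1 <= size gamma)%N ->
         theta gamma = fibsum (epsw (cword gamma))),
      (forall n : nat,
         essential n <-> n = 0%N \/ (odd (mu 1 n) /\ (3 <= mu 1 n)%N)) &
      (forall n : nat,
         essential n <-> exists m : nat,
           (n%:Z = Num.floor (m%:R * tau R) + Num.floor (m%:R * tau R ^+ 2))%R)].
Proof.
have floor_tau := floor_golden_sum (tau_sqr R) (tau_gt0 R).
split=> [gamma _|n|n].
- by rewrite theta_index_sum fibsum_epsw ?cword_proper.
- exact: essential_mu.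
rewrite essential_even_gap2; split=> [[s even_s ->]|[m]].
  by exists (\sum_(i <- s) fib i)%N; rewrite (floor_tau _ even_s).
have [s even_s ->] := even_zeckendorf m; rewrite (floor_tau _ even_s) => -[nE].
by exists s.
Qed.
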